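(* For every $n\ge 1$, the map $\hat{\varphi}:\mathcal{Y}_n\to\mathcal{Q}_n$, from the Tamari lattice $\mathcal{Y}_n$ of binary trees with $n$ internal nodes (viewed as ordered forests of binary trees with $n$ leaves in total grafted to a corolla) to the Boolean lattice $\mathcal{Q}_n$ of subsets of $\{1,\dots,n-1\}$, which replaces the forest by a forest of corollas, is an interval retract.
   Context: Binary trees. A planar rooted binary tree (binary tree) with $n$ internal nodes has $n+1$ leaves; $\mathcal{Y}_n$ denotes the set of these, with the Tamari order: the partial order generated by replacing a subtree $((a\,b)\,c)$ by $(a\,(b\,c))$, the latter being larger; left combs are minimal and right combs maximal. It is a finite lattice. Forests. Ordered forests $(f_1,\dots,f_k)$ ($k\ge1$) of binary trees with $n$ leaves in total (each $f_i$ possibly a single leaf) are identified with $\mathcal{Y}_n$ by attaching the trees in left-to-right order to a single new limb which becomes the left limb: $(f_1,\dots,f_k)\mapsto(\cdots((\,|\,f_1)f_2)\cdots f_k)$, where $|$ is a new leftmost leaf. Such a forest is also pictured as grafted to the $k$ leaves of a painted corolla or painted left comb. Composition trees. A corolla is a rooted tree with one interior node. Replacing each $f_i$ by a corolla (equivalently a right comb) with the same number $w_i\ge1$ of leaves, one obtains a composition tree: a forest of unpainted combs grafted to a painted comb with $k$ leaves; it corresponds to the composition $(w_1,\dots,w_k)$ of $n$. Drawn with combs, a composition tree with $n$ leaves has $n-1$ internal nodes, numbered $1,\dots,n-1$ from left to right (node $i$ separates the $i$-th leaf from the $(i+1)$-st leaf); the painted nodes are those in positions $w_1,\ w_1+w_2,\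 \dots,\ w_1+\cdots+w_{k-1}$. The composition tree is identified with its set of unpainted nodes, a subset of $\{1,\dots,n-1\}$. $\mathcal{Q}_n$ is the set of all such subsets ordered by inclusion. The map. $\hat{\varphi}$ sends the tree corresponding to $(f_1,\dots,f_k)$ to $\{1,\dots,n-1\}\setminus\{w_1,\,w_1+w_2,\dots,w_1+\cdots+w_{k-1}\}$, where $w_i$ is the number of leaves of $f_i$. Interval retract. An interval of a poset is a sub-poset $[a,b]=\{x\mid a\le x\le b\}$. A surjective poset map (order-preserving map) $f:P\to Q$ from a finite lattice $P$ is an interval retract if the fibers of $f$ are intervals and $f$ admits an order-preserving section $g:Q\to P$ with $f\circ g=\mathrm{id}$. *)

(* Defs.v *)
From HB Require Import structures.
From mathcomp Require Import all_boot all_order zify.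

Set Implicit Arguments.
Unset Strict Implicit.
Unset Printing Implicit Defensive.

Import Order.Theory Order.DefaultSetSubsetOrder.

(* Planar rooted binary trees; [Node l r] is the tree written (l r). *)
Inductive btree : Type := Leaf | Node (l r : btree).

Fixpoint nodes (t : btree) : nat :=
  if t is Node l r then (nodes l + nodes r).+1 else 0.

Definition leaves (t : btree) : nat := (nodes t).+1.

Fixpoint encode_btree (t : btree) : GenTree.tree unit :=
  if t is Node l r then GenTree.Node 0 [:: encode_btree l; encode_btree r]
  else GenTree.Leaf tt.

Fixpoint decode_btree (t : GenTree.tree unit) : option btree :=
  match t with
  | GenTree.Leaf _ => Some Leaf
  | GenTree.Node 0 [:: l; r] =>
      if (decode_btree l, decode_btree r) is (Some l', Some r')
      then Some (Node l' r') else None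
  | _ => None
  end.

Lemma encode_btreeK : pcancel encode_btree decode_btree.
Proof. by elim=> //= l -> r ->. Qed.

HB.instance Definition _ := Countable.copy btree (pcan_type encode_btreeK).

(* [rotates s t]: t is obtained from s by replacing exactly one subtree
   ((a b) c) of s by (a (b c)). *)
Fixpoint rotates (s t : btree) : bool :=
  match s, t with
  | Node l r, Node l' r' =>
      [|| (if l is Node a b then (l' == a) && (r' == Node b r) else false),
          rotates l l' && (r == r')
        | (l == l') && rotates r r']
  | _, _ => false
  end.

Record tree (n : nat) : Type :=
  Tree { tree_val :> btree; _ : nodes tree_val == n }.

HB.instance Definition _ n := [isSub for @tree_val n].
HB.instance Definition _ n := [Countable of tree n by <:].

Fixpoint btrees (k : nat) : seq btree :=
  if k is k'.+1
  then Leaf :: [seq Node l r | l <- btrees k', r <- btrees k']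
  else [:: Leaf].

Lemma mem_btrees k t : nodes t <= k -> t \in btrees k.
Proof.
elim: k t => [|k IHk] [|l r] //= lek; rewrite inE; apply/orP; right.
by apply/allpairsP; exists (l, r); split=> //=; apply: IHk; lia.
Qed.

Definition tree_enum n : seq (tree n) := undup (pmap insub (btrees n)).

Lemma tree_enumP n : Finite.axiom (tree_enum n).
Proof.
apply: Finite.uniq_enumP; first exact: undup_uniq.
move=> t; rewrite mem_undup mem_pmap_sub inE /=.
by apply: mem_btrees; rewrite (eqP (valP t)).
Qed.

HB.instance Definition _ n := isFinite.Build (tree n) (@tree_enumP n).

Definition tamari_le (n : nat) : rel (tree n) :=
  connect (fun s t : tree n => rotates s t).

Definition tamari_lt (n : nat) : rel (tree n) :=
  fun s t => (t != s) && tamari_le s t.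

(* The facts up to the lattice instance below show that the Tamari order is a
   lattice order, by means of the vector listing in infix order, for each
   internal node, the number of internal nodes of its right subtree. *)
Fixpoint rvec (t : btree) : seq nat :=
  if t is Node l r then rvec l ++ nodes r :: rvec r else [::].

Lemma size_rvec t : size (rvec t) = nodes t.
Proof. by elim: t => //= l IHl r IHr; rewrite size_cat /= IHl IHr addnS. Qed.

Lemma rotP s t : rotates s t ->
  exists u a b v, [/\ rvec s = u ++ a :: v, rvec t = u ++ b :: v & a < b].
Proof.
elim: s t => [|l IHl r IHr] [|l' r'] //=; case/or3P.
- case: l {IHl} => //= a b /andP[/eqP-> /eqP->].
  exists (rvec a), (nodes b), (nodes b + nodes r).+1, (rvec b ++ nodes r :: rvec r).
  by rewrite /= -catA /=; split=> //; lia.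
- case/andP=> /IHl[u [a [b [v [-> -> ltab]]]]] /eqP<-.
  by exists u, a, b, (v ++ nodes r :: rvec r); rewrite -!catA.
- case/andP=> /eqP<- /[dup] /IHr[u [a [b [v [er er' ltab]]]]] _.
  have -> : nodes r' = nodes r by rewrite -!size_rvec er er' !size_cat.
  exists (rvec l ++ nodes r :: u), a, b, v.
  by rewrite er er' -!catA.
Qed.

Lemma rot_nodes s t : rotates s t -> nodes t = nodes s.
Proof.
by case/rotP=> u [a [b [v [es et _]]]]; rewrite -!size_rvec es et !size_cat.
Qed.

Inductive rots (s : btree) : btree -> Prop :=
| rots0 : rots s s
| rotsS t u : rots s t -> rotates t u -> rots s u.

Lemma rots_trans s t u : rots s t -> rots t u -> rots s u.
Proof. by move=> st; elim=> // v w _ sv vw; apply: rotsS vw. Qed.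

Lemma rots1 s t : rotates s t -> rots s t.
Proof. by move=> st; apply: rotsS st; apply: rots0. Qed.

Lemma rotsl r l l' : rots l l' -> rots (Node l r) (Node l' r).
Proof.
elim=> [|t u _ IH tu]; first exact: rots0.
by apply: rotsS IH _; rewrite /= tu eqxx /= orbT.
Qed.

Lemma rotsr l r r' : rots r r' -> rots (Node l r) (Node l r').
Proof.
elim=> [|t u _ IH tu]; first exact: rots0.
by apply: rotsS IH _; rewrite /= tu eqxx /= !orbT.
Qed.

Lemma rots_nodes s t : rots s t -> nodes t = nodes s.
Proof. by elim=> // u v _ <- /rot_nodes. Qed.

Definition vle (u v : seq nat) := forall i, nth 0 u i <= nth 0 v i.

Lemma rots_vle s t : rots s t -> vle (rvec s) (rvec t).
Proof.
elim=> [i //|u v _ IH /rotP[x [a [b [y [eu ev ltab]]]]] i].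
apply: leq_trans (IH i) _; rewrite eu ev !nth_cat; case: ifP => // _.
by case: (i - size x) => //=; apply: ltnW.
Qed.

Lemma rots_sumn s t : rots s t -> s = t \/ sumn (rvec s) < sumn (rvec t).
Proof.
elim=> [|u v _ IH /rotP[x [a [b [y [eu ev ltab]]]]]]; first by left.
right; have lt_uv : sumn (rvec u) < sumn (rvec v).
  by rewrite eu ev !sumn_cat /=; lia.
by case: IH => [->|/ltn_trans->].
Qed.

Definition rvalid (v : seq nat) := forall i, i < size v ->
  i + nth 0 v i < size v /\
  (forall j, i < j -> j <= i + nth 0 v i -> j + nth 0 v j <= i + nth 0 v i).

Lemma nth_cat_cons u (x : nat) v k :
  nth 0 (u ++ x :: v) (size u + k.+1) = nth 0 v k.
Proof. by rewrite nth_cat ltnNge leq_addr /= addKn. Qed.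

Lemma rvalid_rvec t : rvalid (rvec t).
Proof.
elim: t => [|l IHl r IHr] //= i; rewrite size_cat /= => lti.
case: (ltngtP i (size (rvec l))) => [ltil|ltli|def_i].
- have [h1 h2] := IHl i ltil; rewrite nth_cat ltil; split=> [|j ltij leji].
    by lia.
  by rewrite nth_cat (leq_ltn_trans leji h1); apply: h2.
- have [k def_i] : exists k, i = size (rvec l) + k.+1.
    by exists (i - size (rvec l)).-1; lia.
  subst i; rewrite nth_cat_cons.
  have [|h1 h2] := IHr k; first by lia.
  split=> [|j ltij leji]; first by lia.
  have [m def_j] : exists m, j = size (rvec l) + m.+1.
    by exists (j - size (rvec l)).-1; lia.
  subst j; rewrite nth_cat_cons.
  by have := h2 m; lia.
- rewrite nth_cat def_i ltnn subnn /= size_rvec.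
  split=> [|j ltlj lejr]; first by rewrite size_rvec; lia.
  have [m def_j] : exists m, j = nodes l + m.+1 by exists (j - nodes l).-1; lia.
  subst j; rewrite -size_rvec nth_cat_cons size_rvec.
  by have [] := IHr m; rewrite size_rvec; lia.
Qed.

Lemma rvalid_exists v : rvalid v -> exists t, rvec t = v.
Proof.
have [N] := ubnP (size v); elim: N v => // N IHN [|x0 v0] ltN vv.
  by exists Leaf.
set v := x0 :: v0 in ltN vv.
have exP : exists i, (i < size v) && (i + nth 0 v i == (size v).-1).
  exists (size v).-1; have [] := vv (size v).-1; rewrite /=; lia.
case: (ex_minnP exP) => i /andP[lti /eqP def_i] min_i.
have def_v : v = take i v ++ nth 0 v i :: drop i.+1 v.
  by rewrite -drop_nth // cat_take_drop.
have size_t : size (take i v) = i by rewrite size_take lti.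
have [||l def_l] := IHN (take i v).
- by rewrite size_t; lia.
- move=> j; rewrite size_t => ltji; rewrite nth_take //.
  have [h1 h2] := vv j (ltn_trans ltji lti).
  have lti' : j + nth 0 v j < i.
    rewrite ltnNge; apply/negP=> lei.
    have h3 := h2 i ltji lei.
    suff: i <= j by rewrite leqNgt ltji.
    by apply: min_i; rewrite (ltn_trans ltji lti); apply/eqP; lia.
  split=> // k ltjk lek; rewrite nth_take; first exact: h2.
  exact: leq_ltn_trans lti'.
have [||r def_r] := IHN (drop i.+1 v).
- by rewrite size_drop; lia.
- move=> j; rewrite size_drop nth_drop => ltj.
  have [|h1 h2] := vv (i.+1 + j); first by lia.
  split=> [|k ltjk lek]; first by lia.
  by rewrite nth_drop; have := h2 (i.+1 + k); lia.
exists (Node l r); rewrite /= def_l def_r [RHS]def_v; congr (_ ++ _ :: _).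
by rewrite -size_rvec def_r size_drop; lia.
Qed.

(* A node whose predecessors all have right subtrees ending before it can be
   rotated up to the root. *)
Lemma rots_to_root s p : p < nodes s ->
    (forall j, j < p -> j + nth 0 (rvec s) j < p) ->
  exists l r x, [/\ nodes l = p, rots s (Node l r) &
                    rvec s = rvec l ++ x :: rvec r].
Proof.
elim: s => //= l IHl r _ ltp before.
case: (ltngtP p (nodes l)) => [ltpl|ltlp|->].
- have [|l0 [r0 [x [nl0 ls el]]]] := IHl ltpl.
    move=> j ltjp; have := before j ltjp.
    by rewrite nth_cat size_rvec (ltn_trans ltjp ltpl).
  exists l0, (Node r0 r), x; split=> //; last by rewrite el -catA.
  apply: rots_trans (rotsl _ ls) _; apply: rots1.
  by rewrite /= !eqxx.
- have := before _ ltlp; rewrite nth_cat size_rvec ltnn subnn /=; lia.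
- by exists l, r, (nodes r); split=> //; apply: rots0.
Qed.

Lemma vle_rots s t : nodes s = nodes t -> vle (rvec s) (rvec t) -> rots s t.
Proof.
elim: t s => [|l' IHl r' IHr] s.
  by case: s => // _ _; apply: rots0.
move=> eqn lest.
have [||l [r [x [nl rs es]]]] := @rots_to_root s (nodes l').
- by rewrite eqn /=; lia.
- move=> j ltj; have := lest j; rewrite /= nth_cat size_rvec ltj.
  by have [] := @rvalid_rvec l' j; rewrite ?size_rvec //; lia.
apply: rots_trans rs _.
have nr : nodes r = nodes r'.
  by have := size_rvec s; rewrite es eqn size_cat /= !size_rvec; lia.
apply: rots_trans (rotsl _ (IHl l nl _)) (rotsr _ (IHr r nr _)) => i.
- case: (ltnP i (nodes l')) => [lti|lei]; last by rewrite nth_default ?size_rvec ?nl.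
  by have := lest i; rewrite es /= !nth_cat !size_rvec nl lti.
- have := lest (nodes l' + i.+1).
  by rewrite es /= -{1}nl -!size_rvec !nth_cat_cons.
Qed.

Section TamariOrder.
Variable n : nat.
Implicit Types s t u : tree n.

Lemma nodes_tree t : nodes t = n. Proof. exact/eqP/(valP t). Qed.

Lemma tamari_leP s t : reflect (rots s t) (tamari_le s t).
Proof.
apply: (iffP connectP) => [[p]|].
  elim: p s => [|u p IHp] s /=; first by move=> _ ->; apply: rots0.
  by case/andP=> /rots1 su /IHp/[apply]; apply: rots_trans.
case: t => t nt /= st; elim: st nt => [|u v su IH uv] nt.
  by exists [::] => //; apply: val_inj.
have nu : nodes u == n by rewrite -(rot_nodes uv).
have [p pth lst] := IH nu.
exists (rcons p (Tree nt)); last by rewrite last_rcons.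
by rewrite rcons_path pth -lst.
Qed.

Lemma tamari_vleP s t : tamari_le s t <-> vle (rvec s) (rvec t).
Proof.
split=> [/tamari_leP/rots_vle //|]; move=> h; apply/tamari_leP/vle_rots => //.
by rewrite !nodes_tree.
Qed.

Lemma tamari_refl : reflexive (@tamari_le n).
Proof. by move=> t; apply: connect0. Qed.

Lemma tamari_anti : antisymmetric (@tamari_le n).
Proof.
move=> s t /andP[/tamari_leP/rots_sumn st /tamari_leP/rots_sumn ts].
by apply: val_inj; case: st ts => // lt_st [//|]; rewrite ltnNge (ltnW lt_st).
Qed.

Lemma tamari_trans : transitive (@tamari_le n).
Proof. by move=> t s u; apply: connect_trans. Qed.

Lemma tamari_meet_exists s t :
  exists m : tree n, [forall u, tamari_le u m == tamari_le u s && tamari_le u t].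
Proof.
pose v := mkseq (fun i => minn (nth 0 (rvec s) i) (nth 0 (rvec t) i)) n.
have nth_v i : nth 0 v i = minn (nth 0 (rvec s) i) (nth 0 (rvec t) i).
  case: (ltnP i n) => [ltin|leni]; first by rewrite nth_mkseq.
  by rewrite !nth_default ?size_mkseq ?size_rvec ?nodes_tree.
have [|m def_m] := @rvalid_exists v.
  move=> i; rewrite size_mkseq => lti.
  have [s1 s2] := @rvalid_rvec s i ltac:(by rewrite size_rvec nodes_tree).
  have [t1 t2] := @rvalid_rvec t i ltac:(by rewrite size_rvec nodes_tree).
  rewrite !size_rvec !nodes_tree in s1 t1; rewrite nth_v.
  split=> [|j ltij leji]; first by lia.
  by rewrite nth_v; have := s2 j ltij; have := t2 j ltij; lia.
have nm : nodes m == n by rewrite -size_rvec def_m size_mkseq.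
exists (Tree nm); apply/forallP=> u; apply/eqP; apply/idP/andP.
  move/tamari_vleP => /= h; rewrite def_m in h.
  by split; apply/tamari_vleP => i; have := h i; rewrite nth_v; lia.
case=> /tamari_vleP hs /tamari_vleP ht; apply/tamari_vleP => /= i.
by rewrite def_m nth_v; have := hs i; have := ht i; lia.
Qed.

Definition tamari_meet s t : tree n := xchoose (tamari_meet_exists s t).

Lemma tamari_meetP u s t :
  tamari_le u (tamari_meet s t) = tamari_le u s && tamari_le u t.
Proof. exact/eqP/(forallP (xchooseP (tamari_meet_exists s t))). Qed.

End TamariOrder.

Fixpoint mirror (t : btree) : btree :=
  if t is Node l r then Node (mirror r) (mirror l) else Leaf.

Lemma mirrorK : involutive mirror.
Proof. by elim=> //= l -> r ->. Qed.

Lemma nodes_mirror t : nodes (mirror t) = nodes t.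
Proof. by elim: t => //= l -> r ->; rewrite addnC. Qed.

Lemma rot_mirror s t : rotates s t -> rotates (mirror t) (mirror s).
Proof.
elim: s t => [|l IHl r IHr] [|l' r'] //=; case/or3P.
- by case: l {IHl} => //= a b /andP[/eqP-> /eqP->]; rewrite /= !eqxx.
- by case/andP=> /IHl-> /eqP->; rewrite eqxx !orbT.
- by case/andP=> /eqP-> /IHr->; rewrite eqxx !orbT.
Qed.

Lemma rots_mirror s t : rots s t -> rots (mirror t) (mirror s).
Proof.
elim=> [|u v _ IH /rot_mirror/rots1 uv]; first exact: rots0.
exact: rots_trans uv IH.
Qed.

Section TamariJoin.
Variable n : nat.
Implicit Types s t u : tree n.

Lemma tree_mirror_proof t : nodes (mirror t) == n.
Proof. by rewrite nodes_mirror nodes_tree. Qed.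

Definition tree_mirror t : tree n := Tree (tree_mirror_proof t).

Lemma tree_mirrorK : involutive tree_mirror.
Proof. by move=> t; apply: val_inj; apply: mirrorK. Qed.

Lemma tamari_le_mirror s t :
  tamari_le (tree_mirror s) (tree_mirror t) = tamari_le t s.
Proof.
apply/tamari_leP/tamari_leP => /rots_mirror //=.
by rewrite !mirrorK.
Qed.

Definition tamari_join s t : tree n :=
  tree_mirror (tamari_meet (tree_mirror s) (tree_mirror t)).

Lemma tamari_joinP s t u :
  tamari_le (tamari_join s t) u = tamari_le s u && tamari_le t u.
Proof.
by rewrite -tamari_le_mirror tree_mirrorK tamari_meetP !tamari_le_mirror.
Qed.

End TamariJoin.

Fact tamari_display : Order.disp_t. Proof. exact: Order.Disp tt tt. Qed.

HB.instance Definition _ n :=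
  Order.isPOrder.Build tamari_display (tree n) (lt := @tamari_lt n)
    (fun _ _ => erefl) (@tamari_refl n) (@tamari_anti n) (@tamari_trans n).

HB.instance Definition _ n :=
  Order.POrder_MeetJoin_isLattice.Build tamari_display (tree n)
    (@tamari_meetP n) (@tamari_joinP n).

(* (f_1, ..., f_k) |-> ((.. ((| f_1) f_2) ..) f_k). *)
Definition graft (f : seq btree) : btree := foldl Node Leaf f.

Fixpoint forest (t : btree) : seq btree :=
  if t is Node l r then rcons (forest l) r else [::].

Lemma graftK : cancel graft forest.
Proof.
by elim/last_ind=> // f t IHf; rewrite /graft foldl_rcons /= -/(graft f) IHf.
Qed.

Lemma forestK : cancel forest graft.
Proof. by elim=> //= l IHl r _; rewrite /graft foldl_rcons -/(graft _) IHl. Qed.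

Lemma sumn_leaves_forest t : sumn (map leaves (forest t)) = nodes t.
Proof.
by elim: t => //= l IHl r _; rewrite map_rcons sumn_rcons IHl /leaves addnS.
Qed.

(* {1, ..., n-1}; note the exclusion of 0. *)
Definition position (n : nat) : Type := {i : 'I_n | 0 < i}.

HB.instance Definition _ n := Finite.on (position n).

(* A forest of corollas grafted to a painted corolla, identified with its set of
   unpainted nodes when the corollas are drawn as combs: node i separates the
   i-th leaf from the (i+1)-st. *)
Definition composition_tree (n : nat) : Type := {set position n}.

HB.instance Definition _ n :=
  Order.FinCTBDistrLattice.copy (composition_tree n) {set position n}.

Lemma le_composition_tree n (A B : composition_tree n) :
  (A <= B)%O = (A \subset B).
Proof. by []. Qed.

(* [:: w_1; w_1 + w_2; ...; w_1 + ... + w_(k-1)], for corollas with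
   w_1, ..., w_k leaves. *)
Definition painted (w : seq nat) : seq nat :=
  [seq sumn (take i w) | i <- iota 1 (size w).-1].

Definition unpainted (n : nat) (w : seq nat) : composition_tree n :=
  [set i : position n | val (val i) \notin painted w].

Definition phi_hat (n : nat) (t : tree n) : composition_tree n :=
  unpainted n (map leaves (forest t)).

Local Open Scope order_scope.

Definition poset_map d d' (P : porderType d) (Q : porderType d') (f : P -> Q) :=
  forall x y : P, x <= y -> f x <= f y.

Definition is_interval d (P : porderType d) (A : P -> Prop) :=
  exists a b : P, forall x : P, A x <-> a <= x <= b.

Definition interval_retract d d' (P : finLatticeType d) (Q : porderType d')
    (f : P -> Q) : Prop :=
  [/\ poset_map f,
      forall q : Q, exists p : P, f p = q,
      forall q : Q, is_interval (fun x : P => f x = q)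
    & exists g : Q -> P, poset_map g /\ forall q : Q, f (g q) = q].

(* Main.v *)
Require Import Defs.
From mathcomp Require Import all_boot all_order.
From mathcomp Require Import zify.

(** The Tamari order is the componentwise order on the vectors [rvec t], whose
    entry at a node [j] is the number of nodes of its right subtree, so that
    this subtree occupies the nodes [j + 1, ..., j + v_j] in infix order.  The
    painted nodes of [phi_hat t] are the nodes [p > 0] on the left spine of
    [t], that is, those which lie in no right subtree.  Hence [p] is unpainted
    if and only if some [j < p] has [p <= j + v_j] ([painted_forestE]).  This
    condition is monotone in [v], so [phi_hat] is a poset map.

    Fix a set [A] of nodes, and call run of [i] the number of consecutive
    elements of [A] that follow [i].  Let [B] be a set of nodes containing the
    complement of [A].  The vector equal to the run of [i] at each [i] in [B],
    and to 0 elsewhere, is the vector of a tree [block_tree A B] in the fiber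
    of [A] ([phi_hat_block_tree]).  With [B] the set of all nodes every tree
    of the forest is a right comb; with [B] the complement of [A] every one is
    a left comb.

    A tree in the fiber of [A] lies below the first of these, because every
    right subtree consists of unpainted nodes, and above the second, because
    the right subtree of a spine node contains all the nodes that separate it
    from the next spine node.  Thus the fiber is the interval between the two.
    Runs grow with [A], so the forests of right combs form an order-preserving
    section.  (The forests of left combs do not: enlarging [A] may remove a
    node from its complement, and the entry there drops to 0.) *)

Set Implicit Arguments.
Unset Strict Implicit.
Unset Printing Implicit Defensive.

Import Order.Theory Order.DefaultSetSubsetOrder.

(** * The left spine *)

(** If [v] is [rvec t], this says that [p] lies in the right subtree of some
    node of [t], that is, off the left spine. *)
Definition covered (v : seq nat) (p : nat) : bool :=
  [exists j : 'I_p, p <= j + nth 0 v j].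

Lemma coveredP v p :
  reflect (exists2 j, j < p & p <= j + nth 0 v j) (covered v p).
Proof.
apply: (iffP existsP) => [[j le_p]|[j ltjp le_p]]; first by exists j.
by exists (Ordinal ltjp).
Qed.

Lemma covered_vle u v p : vle u v -> covered u p -> covered v p.
Proof.
move=> le_uv /coveredP[j ltjp le_p]; apply/coveredP; exists j => //.
by apply: leq_trans le_p _; rewrite leq_add2l.
Qed.

Lemma painted_rcons w x : 0 < size w ->
  painted (rcons w x) = rcons (painted w) (sumn w).
Proof.
case: w => // y w _; rewrite /painted size_rcons.
set w' := y :: w; have -> : (size w').+1.-1 = (size w').-1 + 1 by rewrite /w' addn1.
rewrite iotaD map_cat cats1.
congr rcons.
  apply/eq_in_map => i; rewrite mem_iota => /andP[_ lti].
  by rewrite -cats1 takel_cat //; move: lti; rewrite /w' /=; lia.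
have -> : 1 + (size w').-1 = size w' by rewrite /w' add1n.
by rewrite -cats1 take_size_cat.
Qed.

Lemma painted_le w p : p \in painted w -> p <= sumn w.
Proof.
case/mapP=> i _ ->; rewrite -{2}(cat_take_drop i w) sumn_cat.
exact: leq_addr.
Qed.

(** The roots of the successive trees of the forest sit at the partial sums of
    their numbers of leaves: in [Node l r] the root comes right after the nodes
    of [l], and all the nodes after it lie in its right subtree. *)
Lemma painted_forestE t p : 0 < p -> p < nodes t ->
  (p \in painted (map leaves (forest t))) = ~~ covered (rvec t) p.
Proof.
elim: t => //= l IHl r _ p_gt0 ltp.
rewrite map_rcons; set w := map _ _ in IHl *.
have sum_w : sumn w = nodes l by apply: sumn_leaves_forest.
have -> : (p \in painted (rcons w (leaves r))) =
          (p == nodes l) || (p \in painted w).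
  have [/size0nil w0|w_gt0] := posnP (size w).
    by rewrite -sum_w w0 /= eqn0Ngt p_gt0.
  by rewrite painted_rcons // mem_rcons inE sum_w.
case: (ltngtP p (nodes l)) => [ltpl|ltlp|p_def] /=.
- rewrite IHl //; congr (~~ _); apply: eq_existsb => j.
  by rewrite nth_cat size_rvec (ltn_trans (ltn_ord j) ltpl).
- have -> : (p \in painted w) = false.
    by apply/negP => /painted_le; rewrite sum_w leqNgt ltlp.
  apply/esym/negbTE; rewrite negbK; apply/coveredP; exists (nodes l) => //.
  by rewrite nth_cat size_rvec ltnn subnn /=; lia.
- apply/esym; apply/coveredP => -[j ltjp].
  rewrite nth_cat size_rvec -p_def ltjp.
  have [] := @rvalid_rvec l j; rewrite ?size_rvec -?p_def //; lia.
Qed.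

(** * Compositions as sets of nodes *)

Section Fibers.
Variable n : nat.
Implicit Types (A : composition_tree n) (t u : tree n) (B : pred nat).

Definition at_position A (p : nat) : bool :=
  [exists i : position n, (i \in A) && (val (val i) == p)].

Lemma at_positionP A p :
  reflect (exists2 i : position n, i \in A & val (val i) = p) (at_position A p).
Proof.
apply: (iffP existsP) => [[i /andP[iA /eqP]]|[i iA <-]]; first by exists i.
by exists i; rewrite iA eqxx.
Qed.

Lemma at_position_val A (i : position n) : at_position A (val (val i)) = (i \in A).
Proof.
by apply/at_positionP/idP => [[j jA /val_inj/val_inj <-]|]; last exists i.
Qed.

Lemma at_position_bound A p : at_position A p -> 0 < p < n.
Proof. by case/at_positionP=> i _ <-; rewrite (valP i) /=. Qed.

Lemma at_position_inj A A' : at_position A =1 at_position A' -> A = A'.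
Proof. by move=> eqA; apply/setP => i; rewrite -!at_position_val eqA. Qed.

Lemma at_position_sub A A' p :
  A \subset A' -> at_position A p -> at_position A' p.
Proof.
move=> /subsetP sAA' /at_positionP[i /sAA' iA <-].
by rewrite at_position_val.
Qed.

Lemma at_phi_hat t p :
  at_position (phi_hat t) p = (0 < p < n) && covered (rvec t) p.
Proof.
apply/idP/andP => [pA|[p_bd]].
  have p_bd := at_position_bound pA; split=> //.
  case/andP: p_bd => p_gt0 ltpn.
  case/at_positionP: pA => i; rewrite inE => + p_def; rewrite p_def.
  by rewrite painted_forestE ?nodes_tree // negbK.
case/andP: p_bd => p_gt0 ltpn cov_p; apply/at_positionP.
exists (exist (fun i : 'I_n => 0 < i) (Ordinal ltpn) p_gt0) => //.
by rewrite inE /= painted_forestE ?nodes_tree // negbK.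
Qed.

Lemma phi_hat_homo t u : vle (rvec t) (rvec u) -> phi_hat t \subset phi_hat u.
Proof.
move=> le_tu; apply/subsetP => i; rewrite -!at_position_val !at_phi_hat.
by case/andP=> -> /(covered_vle le_tu) ->.
Qed.

(** * Trees with prescribed unpainted nodes *)

Definition run A (i : nat) : nat :=
  find (fun p => ~~ at_position A p) (iota i.+1 (n - i.+1)).

Lemma run_bound A i : i < n -> i + run A i < n.
Proof.
move=> ltin; have := find_size (fun p => ~~ at_position A p) (iota i.+1 (n - i.+1)).
by rewrite size_iota -/(run A i); lia.
Qed.

Lemma at_position_run A i p : i < p <= i + run A i -> at_position A p.
Proof.
move=> /andP[ltip lep].
have lt_run : p - i.+1 < run A i by lia.
have /negbFE := before_find 0 lt_run.
have := find_size (fun p => ~~ at_position A p) (iota i.+1 (n - i.+1)).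
rewrite size_iota -/(run A i) => le_run.
by rewrite nth_iota ?subnKC //; lia.
Qed.

Lemma leq_run A i m : i + m < n ->
  (forall p, i < p <= i + m -> at_position A p) -> m <= run A i.
Proof.
move=> lt_im all_A; rewrite leqNgt; apply/negP => lt_m.
have has_run : has (fun p => ~~ at_position A p) (iota i.+1 (n - i.+1)).
  by rewrite has_find size_iota -/(run A i); lia.
have := nth_find 0 has_run; rewrite -/(run A i) nth_iota; last by lia.
by rewrite all_A //; lia.
Qed.

Lemma run_homo A A' i : A \subset A' -> run A i <= run A' i.
Proof.
move=> sAA'; apply: sub_find => p; apply: contra.
exact: at_position_sub.
Qed.

(** Nodes in [B] get the largest right subtree compatible with [A], the other
    nodes an empty one; both extreme elements of a fiber have this form. *)
Definition block_vec A B : seq nat :=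
  mkseq (fun i => if B i then run A i else 0) n.

Lemma nth_block_vec A B i :
  nth 0 (block_vec A B) i = if (i < n) && B i then run A i else 0.
Proof.
have [ltin|lein] := ltnP i n; first by rewrite nth_mkseq.
by rewrite nth_default ?size_mkseq.
Qed.

Lemma nth_block_vec_le A B i : nth 0 (block_vec A B) i <= run A i.
Proof. by rewrite nth_block_vec; case: ifP. Qed.

(** The run of a node inside the run of [i] stops at the same node outside [A],
    so the runs, seen as segments of nodes, are nested or disjoint, as right
    subtrees must be. *)
Lemma run_nested A i j : i < j <= i + run A i -> i < n ->
  j + run A j <= i + run A i.
Proof.
move=> /andP[ltij lej] ltin; have lt_i := run_bound A ltin.
rewrite leqNgt; apply/negP => lt_run.
suff: (i + run A i).+1 - i <= run A i by lia.
apply: leq_run => [|p p_bd].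
  have := @run_bound A j; lia.
have [lep|ltp] := leqP p (i + run A i).
  by apply: (@at_position_run A i); lia.
by apply: (@at_position_run A j); lia.
Qed.

Lemma rvalid_block_vec A B : rvalid (block_vec A B).
Proof.
move=> i; rewrite size_mkseq => ltin; split=> [|j ltij].
  apply: leq_ltn_trans (run_bound A ltin).
  by rewrite leq_add2l nth_block_vec_le.
rewrite [nth 0 _ i]nth_block_vec ltin /=; case: ifP => [_ lej|_]; last by lia.
apply: leq_trans (_ : j + run A j <= _).
  by rewrite leq_add2l nth_block_vec_le.
by apply: run_nested; rewrite ?ltij.
Qed.

Lemma block_tree_exists A B : exists t, rvec (tree_val t) == block_vec A B.
Proof.
have [t def_t] := rvalid_exists (@rvalid_block_vec A B).
have nt : nodes t == n by rewrite -size_rvec def_t size_mkseq.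
by exists (Tree nt); apply/eqP.
Qed.

Definition block_tree A B : tree n := xchoose (block_tree_exists A B).

Lemma rvec_block_tree A B : rvec (block_tree A B) = block_vec A B.
Proof. exact/eqP/(xchooseP (block_tree_exists A B)). Qed.

(** An element of [A] is covered by the run of the last node before it that is
    outside [A]; there is one, since the node 0 is never in [A]. *)
Lemma phi_hat_block_tree A B :
  (forall i, ~~ at_position A i -> B i) -> phi_hat (block_tree A B) = A.
Proof.
move=> sCAB; apply: at_position_inj => p.
rewrite at_phi_hat rvec_block_tree; apply/andP/idP => [[_]|pA].
  case/coveredP=> j ltjp le_p; apply: (@at_position_run A j).
  by rewrite ltjp (leq_trans le_p) // leq_add2l nth_block_vec_le.
have p_bd := at_position_bound pA; split=> //.
have ex0 : exists j, (j < p) && ~~ at_position A j.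
  by exists 0; case/andP: p_bd => -> _; apply/negP => /at_position_bound.
case: (ex_maxnP (m := p) ex0) => [j /andP[/ltnW]//|j /andP[ltjp jA] max_j].
apply/coveredP; exists j => //.
have ltjn : j < n by lia.
rewrite nth_block_vec ltjn sCAB //= -leq_subLR.
apply: leq_run => [|q q_bd]; first by lia.
have [ltqp|lepq] := ltnP q p; last by have -> : q = p by lia.
by apply: contraLR q_bd => qA; have := max_j q; rewrite ltqp qA; lia.
Qed.

(** * The bounds of a fiber *)

Definition right_combs A : tree n := block_tree A predT.

Definition left_combs A : tree n := block_tree A (fun i => ~~ at_position A i).

(** Every node of a right subtree is unpainted, so the right subtree of [i] is
    no longer than the run of [i]. *)
Lemma le_right_combs t : vle (rvec t) (rvec (right_combs (phi_hat t))).
Proof.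
move=> i; rewrite rvec_block_tree nth_block_vec andbT.
case: ltnP => [ltin|lein]; last by rewrite nth_default ?size_rvec ?nodes_tree.
have [|lt_i _] := @rvalid_rvec t i; first by rewrite size_rvec nodes_tree.
rewrite size_rvec nodes_tree in lt_i.
apply: leq_run => // p /andP[ltip lep]; rewrite at_phi_hat.
by apply/andP; split; [lia | apply/coveredP; exists i].
Qed.

(** Were the right subtree of a spine node [i] shorter than the run of [i], the
    first node after it would be covered by some [j].  No such [j] exists: if
    [j < i] then [j] would cover [i] as well, and the right subtrees of [i] and
    of the nodes below it all end too early. *)
Lemma left_combs_le t : vle (rvec (left_combs (phi_hat t))) (rvec t).
Proof.
move=> i; rewrite rvec_block_tree nth_block_vec.
case: ifP => // /andP[ltin i_spine]; rewrite leqNgt; apply/negP => lt_run.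
have [|lt_i nest_i] := @rvalid_rvec t i; first by rewrite size_rvec nodes_tree.
rewrite size_rvec nodes_tree in lt_i.
have : at_position (phi_hat t) (i + nth 0 (rvec t) i).+1.
  by apply: (@at_position_run _ i); lia.
rewrite at_phi_hat => /andP[_ /coveredP[j ltj lej]].
have [ltji|ltij|eq_ji] := ltngtP j i.
- move: i_spine; rewrite at_phi_hat negb_and; case/orP; first by lia.
  by case/coveredP; exists j => //; lia.
- by have := nest_i j ltij; lia.
- by subst j; lia.
Qed.

Lemma right_combs_homo A A' : A \subset A' ->
  vle (rvec (right_combs A)) (rvec (right_combs A')).
Proof.
move=> sAA' i; rewrite !rvec_block_tree !nth_block_vec.
by case: ifP => // _; apply: run_homo.
Qed.

End Fibers.

Theorem theorem3p4 (n : nat) (n_ge1 : 1 <= n) : interval_retract (@phi_hat n).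
Proof.
have tree_leP (s t : tree n) : (s <= t)%O <-> vle (rvec s) (rvec t).
  exact: tamari_vleP.
have rightK A : phi_hat (right_combs A) = A :> composition_tree n.
  exact: phi_hat_block_tree.
have leftK A : phi_hat (left_combs A) = A :> composition_tree n.
  exact: phi_hat_block_tree.
split.
- by move=> s t /tree_leP; rewrite le_composition_tree; apply: phi_hat_homo.
- by move=> A; exists (right_combs A).
- move=> A; exists (left_combs A), (right_combs A) => t; split=> [<-|].
    by apply/andP; split; apply/tree_leP;
      [apply: left_combs_le | apply: le_right_combs].
  case/andP=> /tree_leP/phi_hat_homo; rewrite leftK => sA /tree_leP/phi_hat_homo.
  by rewrite rightK => As; apply/eqP; rewrite eqEsubset As.
- exists (@right_combs n); split=> // A A'; rewrite le_composition_tree => sAA'.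
  exact/tree_leP/right_combs_homo.
Qed.
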